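(* Let $B\in R^{n+1,n}$ be a minimal Hilbert–Burch matrix whose last row is $H=(h_1,h_2,h_3,0,\ldots,0)$ with $(h_1,h_2,h_3)$ a regular sequence. For $1\le i\le n+1$ let $B_i$ be $(-1)^i$ times the minor obtained from $B$ by removing the $i$-th row. Let $I$ be the ideal generated by $B_1,\ldots,B_n$. Then $I$ is a generalized Gorenstein ideal of homological dimension $3$ with maximal $\zeta(I)$, i.e. $\zeta(I)=\nu(I)-3$.
   Context: $k$ is a field and $R=k[x_1,\ldots,x_r]$, $r\ge 3$, standard graded; ideals, matrices and maps are homogeneous; $n\ge 3$. $R^{p,q}$ denotes the $p\times q$ matrices over $R$. A minimal Hilbert–Burch matrix $B\in R^{n+1,n}$ is the (homogeneous) syzygy matrix in a graded minimal free resolution $0\to R^n\xrightarrow{B}R^{n+1}\to R$ (shifts omitted) of the quotient by a perfect height-two ideal, which is then generated minimally by the maximal minors of $B$. A homogeneous ideal $I$ of homological dimension $3$ (i.e. $R/I$ has projective dimension $3$) is generalized Gorenstein if the last module in the graded minimal free resolution of $R/I$ has rank $1$. If $0\to R\xrightarrow{\rho}R^n\to R^n\to R\to R/I\to 0$ is a minimal free resolution (shifts omitted), $I(\rho)$ is the ideal generated by the components of $\rho(1)$, $\nu(\cdot)$ denotes the minimal number of generators, and $\zeta(I)=\nu(I)-\nu(I(\rho))$; one has $0\le\zeta(I)\le\nu(I)-3$. *)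

(* Defs.v *)
From HB Require Import structures.
From mathcomp Require Import all_boot all_order all_algebra.
From mathcomp Require Import mpoly.

Set Implicit Arguments.
Unset Strict Implicit.
Unset Printing Implicit Defensive.

Import GRing.Theory.
Local Open Scope ring_scope.

(* Ideals of R = k[x_1, ..., x_r] are Prop-valued subsets of {mpoly k[r]};
   R carries its standard grading. *)

Section Ideals.
Variables (k : fieldType) (r : nat).
Local Notation R := {mpoly k[r]}.
Implicit Types (I J P : R -> Prop) (s : seq R).

Definition ideal_gen s : R -> Prop :=
  fun p => exists c : 'I_(size s) -> R, p = \sum_(i < size s) c i * s`_i.

Definition same_ideal I J : Prop := forall p, I p <-> J p.

Definition min_num_gens I (m : nat) : Prop :=
  (exists s, same_ideal I (ideal_gen s) /\ size s = m) /\
  (forall s, same_ideal I (ideal_gen s) -> (m <= size s)%N).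

Definition regular_seq s : Prop :=
  ~ ideal_gen s 1 /\
  (forall i, (i < size s)%N -> forall a : R,
     ideal_gen (take i s) (a * s`_i) -> ideal_gen (take i s) a).

Definition grade I (g : nat) : Prop :=
  (exists s, [/\ regular_seq s, {in s, forall p, I p} & size s = g]) /\
  (forall s, regular_seq s -> {in s, forall p, I p} -> (size s <= g)%N).

Definition prime_ideal P : Prop :=
  [/\ P 0, forall a b, P a -> P b -> P (a + b),
      forall a b, P b -> P (a * b), ~ P 1
    & forall a b, P (a * b) -> P a \/ P b].

(* A strict chain Q 0 < Q 1 < ... < Q l = P of prime ideals. *)
Definition prime_chain P (l : nat) : Prop :=
  exists Q : nat -> R -> Prop,
    [/\ forall i, (i <= l)%N -> prime_ideal (Q i),
        forall i, (i < l)%N ->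
          (forall a, Q i a -> Q i.+1 a) /\ (exists a, Q i.+1 a /\ ~ Q i a)
      & same_ideal (Q l) P].

(* The height of a proper ideal: the least height of a prime containing it. *)
Definition height I (h : nat) : Prop :=
  (forall P, prime_ideal P -> (forall a, I a -> P a) -> prime_chain P h) /\
  (exists P, [/\ prime_ideal P, forall a, I a -> P a & ~ prime_chain P h.+1]).

End Ideals.

Section Resolutions.
Variables (k : fieldType) (r : nat).
Local Notation R := {mpoly k[r]}.

Definition homog_of_deg (d : int) (p : R) : Prop :=
  match d with
  | Posz e => p \is e.-homog
  | Negz _ => p = 0
  end.

Definition exact_mx (m p q : nat) (A : 'M[R]_(m, p)) (C : 'M[R]_(p, q)) : Prop :=
  forall v : 'cV[R]_p, A *m v = 0 <-> exists w : 'cV[R]_q, v = C *m w.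

Definition rk (t : seq nat) (i : nat) : nat := nth 0%N (1%N :: t) i.

(* A graded free resolution of R/I whose modules in homological degrees
   1, ..., size t have the ranks listed in t:
     0 -> R^(t_l) -> ... -> R^(t_1) -> R -> R/I -> 0,   l = size t.
   Matrices act on column vectors.  The modules beyond position l have rank 0,
   so exactness at i = l - 1 says that the last map is injective.  The j-th
   basis vector of the i-th module has degree res_deg i j. *)
Record graded_res (I : R -> Prop) (t : seq nat) := GradedRes {
  res_diff : forall i, 'M[R]_(rk t i, rk t i.+1);
  res_deg : forall i, 'I_(rk t i) -> int;
  res_deg0 : forall j, res_deg (i := 0) j = 0;
  res_homog : forall i a b,
    homog_of_deg (res_deg (i := i.+1) b - res_deg (i := i) a) (res_diff i a b);
  res_image : forall p : R,
    I p <-> exists w : 'cV[R]_(rk t 1), p%:M = res_diff 0 *m w;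
  res_exact : forall i, exact_mx (res_diff i) (res_diff i.+1)
}.

(* All differentials have entries in the ideal (x_1, ..., x_r). *)
Definition minimal_res I t (F : graded_res I t) : Prop :=
  forall i a b, (res_diff F i a b)@_0%MM = 0.

(* The projective dimension of R/I; as everything is graded over a polynomial
   ring, it is measured by graded free resolutions. *)
Definition hom_dim (I : R -> Prop) (d : nat) : Prop :=
  (exists t, inhabited (graded_res I t) /\ size t = d) /\
  (forall t, graded_res I t -> (d <= size t)%N).

Definition perfect (I : R -> Prop) : Prop :=
  exists d, hom_dim I d /\ grade I d.

Definition min_hilbert_burch (n : nat) (B : 'M[R]_(n.+1, n)) : Prop :=
  exists (J : R -> Prop) (F : graded_res J [:: n.+1; n]),
    [/\ perfect J, height J 2, minimal_res F & res_diff F 1 = B].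

Definition signed_minor (n : nat) (B : 'M[R]_(n.+1, n)) (i : 'I_n.+1) : R :=
  (-1) ^+ i.+1 * \det (row' i B).

Definition gen_gorenstein3 (I : R -> Prop) : Prop :=
  hom_dim I 3 /\
  exists (a b : nat) (F : graded_res I [:: a; b; 1%N]), minimal_res F.

(* I(rho), for rho the last map of a resolution with last module of rank 1. *)
Definition rho_ideal I (a b : nat) (F : graded_res I [:: a; b; 1%N]) : R -> Prop :=
  ideal_gen [seq res_diff F 2 i ord0 | i <- enum 'I_b].

(* zeta(I) = z, where zeta(I) = nu(I) - nu(I(rho)); written additively because
   subtraction on nat is truncated.  The minimal graded free resolution is
   unique up to isomorphism, so the choice of F does not affect nurho. *)
Definition has_zeta (I : R -> Prop) (z : nat) : Prop :=
  exists (m : nat) (F : graded_res I [:: m; m; 1%N]) (nuI nurho : nat),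
    [/\ minimal_res F, min_num_gens I nuI, min_num_gens (rho_ideal F) nurho
      & nuI = (z + nurho)%N].

End Resolutions.

(* Main.v *)
Require Import Defs.
From mathcomp Require Import all_boot all_order all_algebra.
From mathcomp Require Import perm mpoly ring.

Set Implicit Arguments.
Unset Strict Implicit.
Unset Printing Implicit Defensive.

Import GRing.Theory.
Local Open Scope ring_scope.

(** The ideal I has the explicit minimal free resolution
      0 -> R --rho--> R^n --B' K--> R^n --(B_1, ..., B_n)--> R,
    where B' is B without its last row H, where K is the direct sum of the 3x3
    Koszul matrix of (h1, h2, h3) and an identity matrix, and where rho is the
    column (h1, h2, h3, 0, ..., 0).

    A syzygy of (B_1, ..., B_n), extended by 0, is a syzygy of all the signed
    minors of B.  Those syzygies are the image of B: expanding a determinant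
    along its first column, v is a syzygy iff det (v | B) = 0, so over a domain
    a nonzero multiple of v lies in the image of B, and v itself does because
    the cokernel of B embeds into R ([signed_minors_exact]).  Hence the syzygies
    of (B_1, ..., B_n) are the B' w with H w = 0, and these w form the image of
    K, as the Koszul complex of a regular sequence is exact ([exact_upper],
    [koszul_exact1]).  If B' K u = 0 then B K u = 0, because H K = 0, so K u = 0
    and u is a multiple of rho ([exact_upper_mul], [koszul_exact2]).

    The entries of all three differentials lie in the ideal of the variables, so
    the resolution is minimal.  A row whose syzygies have no
    constant term generates its ideal minimally ([min_num_gens_row]); this gives
    nu(I) = n and nu(I(rho)) = 3, hence zeta(I) = n - 3.  Finally a resolution
    of length at most 2 would be homotopy equivalent to this one, the homotopy would
    split rho, and rho would have a unit entry ([res_length_ge3]). *)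

(** * Generators of ideals *)

Lemma col_mul (R : pzRingType) m p q (A : 'M[R]_(m, p)) (C : 'M_(p, q)) j :
  col j (A *m C) = A *m col j C.
Proof. by rewrite !colE mulmxA. Qed.

Section GeneratingSets.
Variables (k : fieldType) (r : nat).
Local Notation R := {mpoly k[r]}.

(** Coefficients indexed by nat spare casts between ordinals when the size of
    the list is only provably equal to the expected one. *)
Lemma ideal_gen_natP (s : seq R) (p : R) :
  ideal_gen s p <-> exists c : nat -> R, p = \sum_(i < size s) c i * s`_i.
Proof.
split=> [[c ->]|[c ->]]; last by exists (fun i => c i).
exists (fun i => if insub i is Some j then c j else 0).
by apply: eq_bigr => i _; rewrite valK.
Qed.

Lemma ideal_gen_rowP m (u : 'rV[R]_m) (p : R) :
  ideal_gen [seq u 0 i | i <- enum 'I_m] p <->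
  exists w : 'cV[R]_m, p%:M = u *m w.
Proof.
rewrite ideal_gen_natP size_map size_enum_ord.
have nthu (i : 'I_m) : [seq u 0 i | i <- enum 'I_m]`_i = u 0 i.
  by rewrite (nth_map i) ?size_enum_ord // nth_ord_enum.
split=> [[c ->]|[w /matrixP/(_ 0 0)]].
  exists (\col_i c i); apply/matrixP=> i j; rewrite !ord1 !mxE mulr1n.
  by apply: eq_bigr => l _; rewrite nthu !mxE mulrC.
rewrite !mxE mulr1n => ->.
exists (fun i => if insub i is Some j then w j 0 else 0).
by apply: eq_bigr => l _; rewrite valK nthu mulrC.
Qed.

Lemma ideal_gen_mem (s : seq R) i : (i < size s)%N -> ideal_gen s s`_i.
Proof.
move=> lti; exists (fun j => (j == Ordinal lti)%:R).
rewrite (bigD1 (Ordinal lti)) //= eqxx mul1r big1 ?addr0 // => j /negPf ->.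
by rewrite mul0r.
Qed.

(** Nakayama's lemma in matrix form.  Writing u = s C and s = u D for another
    list s of generators, the columns of 1 - D C are syzygies of u.  Their
    constant terms vanish, so D C is the identity modulo the variables, and the
    identity matrix of size m factors through a space of dimension size s. *)
Lemma min_num_gens_row m (u : 'rV[R]_m) :
  (forall v : 'cV[R]_m, u *m v = 0 -> forall i, (v i 0)@_0%MM = 0) ->
  min_num_gens (ideal_gen [seq u 0 i | i <- enum 'I_m]) m.
Proof.
move=> usyz; split.
  by eexists; split; [move=> p; split; apply | rewrite size_map size_enum_ord].
move=> s sameI.
have /fin_all_exists [C uC] (i : 'I_m) :
    exists c : 'I_(size s) -> R, u 0 i = \sum_(j < size s) c j * s`_j.
  apply/sameI/ideal_gen_rowP; exists (delta_mx i 0).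
  by rewrite -colE; apply/matrixP=> a b; rewrite !ord1 !mxE mulr1n.
have /fin_all_exists [D sD] (j : 'I_(size s)) :
    exists w : 'cV[R]_m, (s`_j)%:M = u *m w.
  by apply/ideal_gen_rowP/sameI/ideal_gen_mem.
pose c0 (p : R) := p@_0%MM.
pose DC := (\matrix_(i, j) D j i 0) *m (\matrix_(j, i) C i j) : 'M_m.
have uDC : u *m DC = u.
  apply/rowP=> i; rewrite mulmxA uC mxE; apply: eq_bigr => j _.
  rewrite mulrC !mxE.
  congr (_ * _); have /matrixP/(_ 0 0) := sD j; rewrite !mxE mulr1n => ->.
  by apply: eq_bigr => l _; rewrite mxE.
have : map_mx (mcoeff 0%MM) (1%:M - DC) = 0 :> 'M[k]_m.
  apply/matrixP=> i j; rewrite !mxE.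
  have := usyz (col j (1%:M - DC)).
  rewrite -col_mul mulmxBr uDC mulmx1 subrr (raddf0 (col j)) => /(_ erefl i).
  by rewrite !mxE.
rewrite map_mxB map_mx1 map_mxM => /eqP.
rewrite subr_eq0 => /eqP/(congr1 mxrank).
rewrite mxrank1 => ->; apply: leq_trans (mxrankM_maxr _ _) _.
exact: rank_leq_row.
Qed.

End GeneratingSets.

(** * Comparison of resolutions *)

Section Comparison.
Variables (k : fieldType) (r : nat).
Local Notation R := {mpoly k[r]}.

Lemma exact_mx_lift m p q l (A : 'M[R]_(m, p)) (C : 'M[R]_(p, q))
    (X : 'M[R]_(p, l)) :
  exact_mx A C -> A *m X = 0 -> exists W, X = C *m W.
Proof.
move=> exAC AX0.
have /fin_all_exists [W XW] (j : 'I_l) : exists w : 'cV[R]_q, col j X = C *m w.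
  by apply/exAC; rewrite -col_mul AX0 (raddf0 (col j)).
exists (\matrix_(i, j) W j i 0); apply/matrixP=> i j.
have /matrixP/(_ i 0) := XW j; rewrite !mxE => ->.
by apply: eq_bigr => a _; rewrite mxE.
Qed.

Lemma exact_mx_comp m p q (A : 'M[R]_(m, p)) (C : 'M[R]_(p, q)) :
  exact_mx A C -> A *m C = 0.
Proof.
move=> exAC; apply/matrixP=> i j.
have /matrixP/(_ i 0) : A *m col j C = 0.
  by apply/exAC; exists (delta_mx j 0); rewrite colE.
by rewrite -col_mul !mxE.
Qed.

Lemma mulmx_inj m p l (A : 'M[R]_(m, p)) (X : 'M[R]_(p, l)) :
  (forall v : 'cV[R]_p, A *m v = 0 -> v = 0) -> A *m X = 0 -> X = 0.
Proof.
move=> injA AX0; apply/matrixP=> i j.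
have /matrixP/(_ i 0) : col j X = 0.
  by apply: injA; rewrite -col_mul AX0 (raddf0 (col j)).
by rewrite !mxE.
Qed.

Lemma same_image_lift m p q (A : 'M[R]_(1, p)) (C : 'M[R]_(1, q))
    (I : R -> Prop) :
  (forall x, I x <-> exists w : 'cV_p, x%:M = A *m w) ->
  (forall x, I x <-> exists w : 'cV_q, x%:M = C *m w) ->
  forall X : 'M_(p, m), exists W, A *m X = C *m W.
Proof.
move=> imA imC X.
have /fin_all_exists [W XW] (j : 'I_m) :
    exists w : 'cV[R]_q, A *m col j X = C *m w.
  have [//|w Aw] := (imC ((A *m col j X) 0 0)).1.
    by apply/imA; exists (col j X); rewrite -mx11_scalar.
  by exists w; rewrite -Aw -mx11_scalar.
exists (\matrix_(i, j) W j i 0); apply/matrixP=> i j.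
have /matrixP/(_ i 0) := XW j; rewrite -col_mul !mxE => ->.
by apply: eq_bigr => a _; rewrite mxE.
Qed.
(** If t had size at most 2, the comparison maps f from the given complex to G
    and g back would have a composite homotopic to the identity, via s1 and s2.
    In degree 3 the module of G vanishes and the homotopy reads s2 rho = 1, which
    is impossible when rho has no constant terms. *)
Lemma res_length_ge3 a b (M : 'rV[R]_a) (A : 'M[R]_(a, b)) (rho : 'cV[R]_b)
    (I : R -> Prop) t :
  (forall p, I p <-> exists w : 'cV_a, p%:M = M *m w) ->
  exact_mx M A -> exact_mx A rho ->
  (forall v : 'cV_1, rho *m v = 0 -> v = 0) ->
  (forall i, (rho i 0)@_0%MM = 0) ->
  graded_res I t -> (3 <= size t)%N.
Proof.
move=> imM exMA exAr injr rho0 G; rewrite ltnNge; apply/negP => le2.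
have rk3 : rk t 3 = 0%N by rewrite /rk nth_default.
(* Since its third module is zero, G has an injective second differential. *)
pose d0 : 'rV_(rk t 1) := res_diff G 0.
pose d1 : 'M_(rk t 1, rk t 2) := res_diff G 1.
have ex01 : exact_mx d0 d1 := @res_exact _ _ _ _ G 0.
have injd1 (v : 'cV_(rk t 2)) : d1 *m v = 0 -> v = 0.
  move=> /(@res_exact _ _ _ _ G 1 v).1[w ->].
  apply/matrixP=> i j; rewrite !mxE big1 // => l.
  by have := ltn_ord l; rewrite [X in (_ < X)%N]rk3.
have imG : forall p, I p <-> exists w : 'cV_(rk t 1), p%:M = d0 *m w.
  exact: res_image.
have [f1 df1] := same_image_lift imM imG 1%:M.
have [g1 dg1] := same_image_lift imG imM 1%:M.
rewrite !mulmx1 in df1 dg1.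
have [|f2 df2] := @exact_mx_lift _ _ _ _ _ _ (f1 *m A) ex01.
  by rewrite mulmxA -df1 exact_mx_comp.
have [|g2 dg2] := @exact_mx_lift _ _ _ _ _ _ (g1 *m d1) exMA.
  by rewrite mulmxA -dg1 exact_mx_comp.
have [|s1 ds1] := @exact_mx_lift _ _ _ _ _ _ (1%:M - g1 *m f1) exMA.
  by rewrite mulmxBr mulmx1 mulmxA -dg1 -df1 subrr.
have [|s2 ds2] := @exact_mx_lift _ _ _ _ _ _ (1%:M - g2 *m f2 - s1 *m A) exAr.
  rewrite !mulmxBr mulmx1 !mulmxA -dg2 -ds1 mulmxBl mul1mx.
  by rewrite -!mulmxA -df2 opprB addrC addrA subrK subrr.
have f2r : f2 *m rho = 0.
  apply: (mulmx_inj injd1).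
  by rewrite mulmxA -df2 -mulmxA (exact_mx_comp exAr) mulmx0.
have : rho *m (1%:M - s2 *m rho) = 0.
  rewrite mulmxBr mulmx1 mulmxA -ds2 !mulmxBl mul1mx -!mulmxA f2r.
  by rewrite (exact_mx_comp exAr) !mulmx0 !subr0 subrr.
move=> /(mulmx_inj injr)/matrixP/(_ 0 0)/(congr1 (mcoeff 0%MM)).
rewrite !mxE mcoeffB raddf0 mcoeff1 eqxx raddf_sum big1 ?subr0 => [|i _].
  by move/eqP; rewrite oner_eq0.
by rewrite -[LHS]/(mcoeff 0%MM _) rmorphM /= rho0 mulr0.
Qed.
End Comparison.

(** * The Koszul complex of three elements *)

Section Koszul.
Variables (k : fieldType) (r : nat).
Local Notation R := {mpoly k[r]}.

(** The cross product u |-> h x u; indices are added modulo 3. *)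
Definition koszul (h : 'rV[R]_3) : 'M[R]_3 :=
  \matrix_(i, j) (h 0 (i + 1) *+ (j == i + 2) - h 0 (i + 2) *+ (j == i + 1)).

Lemma sum_ord3 (V : nmodType) (F : 'I_3 -> V) :
  \sum_i F i = F 0 + F 1 + F 2.
Proof.
rewrite !big_ord_recl big_ord0 addr0 addrA.
by congr (F _ + F _ + F _); apply: val_inj.
Qed.

Lemma ord3P (P : 'I_3 -> Prop) : P 0 -> P 1 -> P 2 -> forall i, P i.
Proof.
move=> P0 P1 P2 [[|[|[|//]]] lti].
- by rewrite (_ : Ordinal lti = 0) //; apply: val_inj.
- by rewrite (_ : Ordinal lti = 1) //; apply: val_inj.
- by rewrite (_ : Ordinal lti = 2) //; apply: val_inj.
Qed.

Lemma koszulE h (u : 'cV[R]_3) i :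
  (koszul h *m u) i 0 = h 0 (i + 1) * u (i + 2) 0 - h 0 (i + 2) * u (i + 1) 0.
Proof.
have d12 : (i + 2 == i + 1) = false by rewrite (inj_eq (addrI i)).
have d21 : (i + 1 == i + 2) = false by rewrite (inj_eq (addrI i)).
rewrite mxE (bigD1 (i + 2)) //= (bigD1 (i + 1)) ?d21 //= big1 ?addr0.
  by rewrite !mxE !eqxx d12 d21 subr0 sub0r mulNr.
move=> j /andP[/negPf j2 /negPf j1].
by rewrite !mxE j1 j2 subrr mul0r.
Qed.

Lemma koszulE3 h (u : 'cV[R]_3) :
  [/\ (koszul h *m u) 0 0 = h 0 1 * u 2 0 - h 0 2 * u 1 0,
      (koszul h *m u) 1 0 = h 0 2 * u 0 0 - h 0 0 * u 2 0
    & (koszul h *m u) 2 0 = h 0 0 * u 1 0 - h 0 1 * u 0 0].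
Proof.
rewrite !koszulE; split; congr (h _ _ * u _ _ - h _ _ * u _ _); exact: val_inj.
Qed.

Lemma ideal_gen0 (p : R) : ideal_gen [::] p <-> p = 0.
Proof.
split=> [[c ->]|->]; first by rewrite big_ord0.
by exists (fun=> 0); rewrite big_ord0.
Qed.

Lemma ideal_gen1 (a p : R) : ideal_gen [:: a] p <-> exists c, p = c * a.
Proof.
rewrite ideal_gen_natP; split=> [[c ->]|[c ->]].
  by exists (c 0%N); rewrite big_ord_recl big_ord0 addr0.
by exists (fun=> c); rewrite big_ord_recl big_ord0 addr0.
Qed.

Lemma ideal_gen2 (a b p : R) :
  ideal_gen [:: a; b] p <-> exists c d, p = c * a + d * b.
Proof.
rewrite ideal_gen_natP; split=> [[c ->]|[c [d ->]]].
  by exists (c 0%N), (c 1%N); rewrite !big_ord_recl big_ord0 addr0.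
by exists (fun i => if i is 0%N then c else d); rewrite !big_ord_recl big_ord0 addr0.
Qed.

Section RegularSequence.
Variables h1 h2 h3 : R.
Hypothesis hreg : regular_seq [:: h1; h2; h3].

Let reg1 a : a * h1 = 0 -> a = 0.
Proof.
by move=> ah; apply/ideal_gen0/(hreg.2 0%N isT)/ideal_gen0.
Qed.

Let reg2 a : (exists c, a * h2 = c * h1) -> exists c, a = c * h1.
Proof.
by move=> ah; apply/ideal_gen1/(hreg.2 1%N isT)/ideal_gen1.
Qed.

Let reg3 a : (exists c d, a * h3 = c * h1 + d * h2) ->
  exists c d, a = c * h1 + d * h2.
Proof.
by move=> ah; apply/ideal_gen2/(hreg.2 2%N isT)/ideal_gen2.
Qed.

(** Regularity is used from the last element down: w3 lies in (h1, h2); after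
    subtracting Koszul relations w2 lies in (h1), and then w1 vanishes. *)
Lemma regular_seq3_syz w1 w2 w3 : h1 * w1 + h2 * w2 + h3 * w3 = 0 ->
  exists u1 u2 u3, [/\ w1 = h2 * u3 - h3 * u2, w2 = h3 * u1 - h1 * u3
                     & w3 = h1 * u2 - h2 * u1].
Proof.
move=> syz.
have [|a [b w3E]] := @reg3 w3.
  by exists (- w1), (- w2); apply/eqP; rewrite -subr_eq0 -syz; apply/eqP; ring.
have [|c w2E] := @reg2 (w2 + b * h3).
  exists (- (w1 + a * h3)); apply/eqP; rewrite -subr_eq0 -syz w3E.
  by apply/eqP; ring.
have w2E' : w2 = c * h1 - b * h3 by rewrite -w2E addrK.
have w1E : w1 + a * h3 + c * h2 = 0.
  by apply: reg1; rewrite -syz w3E w2E'; ring.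
exists (- b), a, (- c); split; last by rewrite w3E; ring.
- by apply/eqP; rewrite -subr_eq0 -w1E; apply/eqP; ring.
- by rewrite w2E'; ring.
Qed.

(** The last hypothesis puts u1 in (h1), as h2 is regular modulo h1; cancelling
    h1 then determines u2 and u3. *)
Lemma regular_seq3_cycle u1 u2 u3 :
  h3 * u1 - h1 * u3 = 0 -> h1 * u2 - h2 * u1 = 0 ->
  exists c, [/\ u1 = h1 * c, u2 = h2 * c & u3 = h3 * c].
Proof.
move=> /eqP; rewrite subr_eq0 => /eqP e2 /eqP; rewrite subr_eq0 => /eqP e3.
have [|c u1E] := @reg2 u1; first by exists u2; rewrite mulrC -e3 mulrC.
exists c; split; first by rewrite u1E mulrC.
- apply/eqP; rewrite -subr_eq0; apply/eqP/reg1.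
  by rewrite mulrBl mulrC e3 u1E; ring.
- apply/eqP; rewrite -subr_eq0; apply/eqP/reg1.
  by rewrite mulrBl mulrC -e2 u1E; ring.
Qed.

Lemma regular_seq_head_neq0 : h1 != 0.
Proof.
apply/eqP=> h10; have := oner_neq0 R.
by rewrite (reg1 (a := 1)) ?eqxx // h10 mulr0.
Qed.
End RegularSequence.

Section KoszulExact.
Variable h : 'rV[R]_3.
Hypothesis hreg : regular_seq [:: h 0 0; h 0 1; h 0 2].

Lemma koszul_exact1 : exact_mx h (koszul h).
Proof.
move=> w; split=> [/matrixP/(_ 0 0)|[u ->]].
  rewrite !mxE sum_ord3 => /(regular_seq3_syz hreg)[u1 [u2 [u3 [w1 w2 w3]]]].
  exists (\col_i [:: u1; u2; u3]`_i).
  have [Ku0 Ku1 Ku2] := koszulE3 h (\col_i [:: u1; u2; u3]`_i).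
  rewrite ![(\col__ _) _ _]mxE /= in Ku0 Ku1 Ku2.
  by apply/colP; apply: ord3P; rewrite ?Ku0 ?Ku1 ?Ku2.
have [Ku0 Ku1 Ku2] := koszulE3 h u.
by apply/matrixP=> i j; rewrite !ord1 mxE sum_ord3 Ku0 Ku1 Ku2 !mxE; ring.
Qed.

Lemma koszul_exact2 : exact_mx (koszul h) h^T.
Proof.
move=> u; have [Ku0 Ku1 Ku2] := koszulE3 h u; split=> [Ku|[c uE]].
  rewrite Ku !mxE in Ku0 Ku1 Ku2.
  have [||c [u1 u2 u3]] :=
    @regular_seq3_cycle _ _ _ hreg (u 0 0) (u 1 0) (u 2 0).
  - by rewrite -Ku1.
  - by rewrite -Ku2.
  by exists c%:M; apply/colP; apply: ord3P; rewrite mxE big_ord1 !mxE mulr1n.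
by apply/colP; apply: ord3P; rewrite ?Ku0 ?Ku1 ?Ku2 uE !mxE !big_ord1 !mxE; ring.
Qed.

Lemma regular_row_inj (v : 'cV[R]_1) : h^T *m v = 0 -> v = 0.
Proof.
move=> /matrixP/(_ 0 0); rewrite !mxE big_ord1 !mxE => /eqP.
rewrite mulf_eq0 (negPf (regular_seq_head_neq0 hreg)) => /eqP v0.
by apply/matrixP=> i j; rewrite !ord1 v0 mxE.
Qed.
End KoszulExact.
End Koszul.

(** * Syzygies of the maximal minors *)

Section Determinantal.
Variables (k : fieldType) (r : nat).
Local Notation R := {mpoly k[r]}.
Variables (n : nat) (B : 'M[R]_(n.+1, n)).

Lemma signed_minors_det (v : 'cV[R]_n.+1) :
  \sum_i signed_minor B i * v i 0 = - \det (row_mx v B : 'M_(1 + n)).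
Proof.
rewrite (expand_det_col _ (0 : 'I_(1 + n))) -sumrN; apply: eq_bigr => i _.
have -> : (row_mx v B : 'M_(1 + n)) i 0 = v i 0.
  by rewrite -(row_mxEl v B); congr (row_mx _ _ _ _); apply: val_inj.
rewrite /cofactor addn0 (_ : col' (0 : 'I_(1 + n)) (row_mx v B) = B).
  by rewrite /signed_minor exprS; ring.
apply/matrixP=> a b; rewrite mxE -(row_mxEr v B).
by congr (row_mx _ _ _ _); apply: val_inj.
Qed.

(** Any row F with kernel the image of B will do: it serves to cancel scalars,
    since t v = - B w gives t F v = 0 and hence F v = 0. *)
Lemma signed_minors_exact (F : 'rV[R]_n.+1) :
  exact_mx F B -> (forall w : 'cV[R]_n, B *m w = 0 -> w = 0) ->
  exact_mx (\row_i signed_minor B i) B.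
Proof.
move=> exFB injB v.
have minorsE (u : 'cV_n.+1) : (\row_i signed_minor B i *m u = 0) <->
    \det (row_mx u B : 'M_(1 + n)) = 0.
  have -> : \row_i signed_minor B i *m u = (- \det (row_mx u B : 'M_(1 + n)))%:M.
    apply/matrixP=> i j; rewrite !ord1 !mxE mulr1n -signed_minors_det.
    by apply: eq_bigr => l _; rewrite mxE.
  split=> [/matrixP/(_ 0 0)|->]; last by rewrite oppr0 raddf0.
  by rewrite !mxE mulr1n => /eqP; rewrite oppr_eq0 => /eqP.
split=> [/minorsE/eqP|[w vE]]; last first.
  apply/minorsE/eqP; rewrite -det_tr; apply/det0P.
  exists (row_mx 1%:M (- w^T)).
    apply/eqP=> /matrixP/(_ 0 (lshift n 0)); rewrite row_mxEl !mxE => /eqP.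
    by rewrite oner_eq0.
  by rewrite tr_row_mx mul_row_col mul1mx mulNmx -trmx_mul vE subrr.
rewrite -det_tr => /det0P[z z0 /(congr1 trmx)].
rewrite trmx_mul trmxK trmx0 -[z]hsubmxK tr_row_mx mul_row_col.
set t := lsubmx z; set w := rsubmx z => Bw.
have t0 : t 0 0 != 0.
  apply: contraNneq z0 => t0; have t0' : t = 0.
    by apply/matrixP=> i j; rewrite !ord1 t0 mxE.
  move: Bw; rewrite t0' trmx0 mulmx0 add0r => /injB/(congr1 trmx).
  by rewrite trmxK trmx0 -[z]hsubmxK -/t -/w t0' => ->; rewrite row_mx0.
apply/exFB/matrixP=> i j.
have /matrixP/(_ i 0) : F *m (v *m t^T) = 0.
  have /eqP -> : v *m t^T == - (B *m w^T) by rewrite -addr_eq0 Bw.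
  by rewrite -mulmxN mulmxA (exact_mx_comp exFB) mul0mx.
rewrite mulmxA [LHS]mxE big_ord1 [t^T _ _]mxE [RHS]mxE => /eqP.
by rewrite mulf_eq0 (negPf t0) orbF !ord1 [RHS]mxE => /eqP.
Qed.

Let upper : 'M[R]_n := rowsub (widen_ord (leqnSn n)) B.
Let last_row : 'rV[R]_n := row ord_max B.

(** A syzygy v of the truncated row extends by 0 to a syzygy B w of g, and the
    vanishing of its last coordinate says that w is killed by the last row. *)
Lemma exact_upper m (g : 'rV[R]_n.+1) (K : 'M[R]_(n, m)) :
  exact_mx g B -> exact_mx last_row K ->
  exact_mx (\row_i g 0 (widen_ord (leqnSn n) i)) (upper *m K).
Proof.
move=> exgB exK v.
pose ext := \col_i oapp (v^~ 0) 0 (unlift ord_max i) : 'cV[R]_n.+1.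
have widenE i : widen_ord (leqnSn n) i = lift ord_max i.
  by apply: val_inj; rewrite /= /bump leqNgt ltn_ord.
have ext_widen i : ext (widen_ord (leqnSn n) i) 0 = v i 0.
  by rewrite mxE widenE liftK.
have ext_max : ext ord_max 0 = 0 by rewrite mxE unlift_none.
have -> : \row_i g 0 (widen_ord (leqnSn n) i) *m v = g *m ext.
  apply/matrixP=> i j; rewrite !ord1 !mxE big_ord_recr /= ext_max mulr0 addr0.
  by apply: eq_bigr => l _; rewrite ext_widen mxE.
split=> [/exgB[w extE]|[u vE]].
  have /exK[u wE] : last_row *m w = 0.
    by rewrite -row_mul -extE; apply/matrixP=> i j; rewrite !ord1 !mxE unlift_none.
  exists u; rewrite -mulmxA -wE; apply/colP=> i; rewrite -ext_widen extE !mxE.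
  by apply: eq_bigr => l _; rewrite !mxE.
apply/exgB; exists (K *m u); apply/colP=> i.
case: (unliftP ord_max i) => [j ->|->]; last first.
  rewrite ext_max; have : last_row *m (K *m u) = 0.
    by rewrite mulmxA (exact_mx_comp exK) mul0mx.
  by rewrite -row_mul => /matrixP/(_ 0 0); rewrite !mxE.
rewrite -widenE ext_widen vE -mulmxA !mxE.
by apply: eq_bigr => l _; rewrite !mxE.
Qed.

(** The last row kills K u, so B' K u = 0 already forces B K u = 0. *)
Lemma exact_upper_mul m p (K : 'M[R]_(n, m)) (rho : 'M[R]_(m, p)) :
  (forall w : 'cV[R]_n, B *m w = 0 -> w = 0) ->
  exact_mx last_row K -> exact_mx K rho -> exact_mx (upper *m K) rho.
Proof.
move=> injB exHK exKrho u; split=> [uKu|[w ->]]; last first.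
  by rewrite -mulmxA [K *m _]mulmxA (exact_mx_comp exKrho) mul0mx mulmx0.
apply/exKrho/injB/colP=> i.
case: (unliftP ord_max i) => [j ->|->]; last first.
  have : last_row *m (K *m u) = 0.
    by rewrite mulmxA (exact_mx_comp exHK) mul0mx.
  by rewrite -row_mul => /matrixP/(_ 0 0); rewrite !mxE.
move: uKu; rewrite -mulmxA => /matrixP/(_ j 0); rewrite !mxE => {2}<-.
apply: eq_bigr => l _; rewrite !mxE; congr (B _ _ * _); apply: val_inj.
by rewrite /= /bump leqNgt ltn_ord.
Qed.
End Determinantal.

(** * Adding a trivial summand to an exact sequence *)

Section Padding.
Variables (k : fieldType) (r : nat).
Local Notation R := {mpoly k[r]}.

Lemma exact_pad m a b p (g : 'M[R]_(m, a)) (A : 'M[R]_(a, b)) :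
  exact_mx g A -> exact_mx (row_mx g 0) (block_mx A 0 0 (1%:M : 'M_p)).
Proof.
move=> exgA v; rewrite -[v]vsubmxK mul_row_col mul0mx addr0.
split=> [/exgA[u ->]|[u]].
  exists (col_mx u (dsubmx v)).
  by rewrite mul_block_col !mul0mx mul1mx addr0 add0r.
rewrite -[u]vsubmxK mul_block_col !mul0mx addr0 => /eq_col_mx[-> _].
by rewrite mulmxA (exact_mx_comp exgA) mul0mx.
Qed.

Lemma exact_pad_last a b c p (A : 'M[R]_(a, b)) (rho : 'M[R]_(b, c)) :
  exact_mx A rho -> exact_mx (block_mx A 0 0 (1%:M : 'M_p)) (col_mx rho 0).
Proof.
move=> exAr v; rewrite -[v]vsubmxK mul_block_col !mul0mx mul1mx addr0 add0r.
split=> [/eqP|[w]].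
  rewrite col_mx_eq0 => /andP[/eqP/exAr[w ->] /eqP->].
  by exists w; rewrite mul_col_mx mul0mx.
rewrite mul_col_mx mul0mx => /eq_col_mx[-> ->].
by rewrite mulmxA (exact_mx_comp exAr) mul0mx col_mx0.
Qed.
End Padding.

(** * Degrees of matrix entries *)

Section Homogeneity.
Variables (k : fieldType) (r : nat).
Local Notation R := {mpoly k[r]}.
Implicit Types (p q : R) (d e : int).

Lemma homog_of_deg0 d : homog_of_deg d (0 : R).
Proof. by case: d => //= d; apply: dhomog0. Qed.

Lemma homog_of_deg1 : homog_of_deg 0 (1 : R).
Proof. exact: dhomog1. Qed.

Lemma homog_of_degD d p q :
  homog_of_deg d p -> homog_of_deg d q -> homog_of_deg d (p + q).
Proof.
by case: d => d /=; [apply: dhomogD | move=> -> ->; rewrite addr0].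
Qed.

Lemma homog_of_degN d p : homog_of_deg d p -> homog_of_deg d (- p).
Proof. by case: d => d /=; [rewrite rpredN | move=> ->; rewrite oppr0]. Qed.

Lemma homog_of_degM d e p q :
  homog_of_deg d p -> homog_of_deg e q -> homog_of_deg (d + e) (p * q).
Proof.
case: d => d /=; last by move=> -> _; rewrite mul0r; apply: homog_of_deg0.
case: e => e /= hp; last by move=> ->; rewrite mulr0; apply: homog_of_deg0.
exact: dhomogM.
Qed.

Lemma homog_of_deg_sum (T : finType) d (F : T -> R) :
  (forall i, homog_of_deg d (F i)) -> homog_of_deg d (\sum_i F i).
Proof.
by move=> hF; elim/big_ind: _ => *; [apply: homog_of_deg0 | apply: homog_of_degD |].
Qed.

Lemma homog_of_deg_prod (T : finType) (d : T -> int) (F : T -> R) :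
  (forall i, homog_of_deg (d i) (F i)) ->
  homog_of_deg (\sum_i d i) (\prod_i F i).
Proof.
move=> hF; elim/big_ind2: _ => *; [exact: homog_of_deg1 | exact: homog_of_degM |].
exact: hF.
Qed.

Lemma homog_of_deg_sign d b p : homog_of_deg d p -> homog_of_deg d ((-1) ^+ b * p).
Proof.
by move=> hp; rewrite -signr_odd mulr_sign; case: ifP => // _; apply: homog_of_degN.
Qed.

Lemma homog_of_deg_mulmx a b c (d : 'I_a -> int) (e : 'I_b -> int)
    (f : 'I_c -> int) (A : 'M[R]_(a, b)) (C : 'M[R]_(b, c)) :
  (forall i j, homog_of_deg (e j - d i) (A i j)) ->
  (forall i j, homog_of_deg (f j - e i) (C i j)) ->
  forall i j, homog_of_deg (f j - d i) ((A *m C) i j).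
Proof.
move=> hA hC i j; rewrite mxE; apply: homog_of_deg_sum => l.
have -> : f j - d i = (e l - d i) + (f j - e l) by ring.
exact: homog_of_degM.
Qed.

Lemma homog_of_deg_det a (d e : 'I_a -> int) (A : 'M[R]_a) :
  (forall i j, homog_of_deg (e j - d i) (A i j)) ->
  homog_of_deg (\sum_j e j - \sum_i d i) (\det A).
Proof.
move=> hA; apply: homog_of_deg_sum => s; apply: homog_of_deg_sign.
rewrite (reindex_inj (@perm_inj _ s)) -sumrB.
by apply: homog_of_deg_prod => i; apply: hA.
Qed.

Lemma homog_signed_minor a (d : 'I_a.+1 -> int) (e : 'I_a -> int)
    (B : 'M[R]_(a.+1, a)) :
  (forall i j, homog_of_deg (e j - d i) (B i j)) ->
  forall i, homog_of_deg (\sum_j e j - \sum_l d l + d i) (signed_minor B i).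
Proof.
move=> hB i; apply: homog_of_deg_sign.
have -> : \sum_j e j - \sum_l d l + d i = \sum_j e j - \sum_l d (lift i l).
  by rewrite (bigD1_ord i) //=; ring.
by apply: homog_of_deg_det => l j; rewrite mxE.
Qed.
End Homogeneity.

Section KoszulDegrees.
Variables (k : fieldType) (r : nat).
Local Notation R := {mpoly k[r]}.

(** The j-th Koszul relation combines the two basis vectors other than the j-th,
    with coefficients h; its degree is the sum of their degrees minus d. *)
Lemma koszul_homog (h : 'rV[R]_3) (c : 'I_3 -> int) (d : int) :
  (forall i, homog_of_deg (c i - d) (h 0 i)) ->
  forall i j, homog_of_deg (\sum_l c l - d - c j - c i) (koszul h i j).
Proof.
move=> hh i j.
have sumE : \sum_l c l = c i + c (i + 1) + c (i + 2).
  by rewrite (reindex_inj (addrI i)) sum_ord3 addr0.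
rewrite mxE sumE; apply: homog_of_degD; last apply: homog_of_degN.
all: have [->|_] := eqVneq j; rewrite ?mulr0n ?mulr1n; try exact: homog_of_deg0.
- by rewrite (_ : _ - _ - _ - _ = c (i + 1) - d) //; ring.
- by rewrite (_ : _ - _ - _ - _ = c (i + 2) - d) //; ring.
Qed.

(** Here e and d are read off the matrix B; f grades the second module of the
    resolution and f' the last one, up to a common shift. *)
Lemma koszul_pad_homog p (h : 'rV[R]_3) (e : 'I_(3 + p) -> int) (d : int) :
  (forall i, homog_of_deg (e (lshift p i) - d) (h 0 i)) ->
  exists f : 'I_(3 + p) -> int, exists f' : int,
    (forall i j, homog_of_deg (f j - e i)
       ((block_mx (koszul h) 0 0 1%:M : 'M_(3 + p)) i j)) /\
    (forall i j, homog_of_deg (f' - f i) ((col_mx h^T 0 : 'cV_(3 + p)) i j)).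
Proof.
move=> hh; pose s := \sum_l e (lshift p l) - d.
exists (fun j => match split j with
  | inl j' => s - e (lshift p j') | inr j' => e (rshift 3 j') end), (s - d).
split=> i j.
  case: (split_ordP i) => i' ->; case: (split_ordP j) => j' ->.
  - by rewrite block_mxEul; apply: koszul_homog.
  - by rewrite block_mxEur mxE; apply: homog_of_deg0.
  - by rewrite block_mxEdl mxE; apply: homog_of_deg0.
  rewrite block_mxEdr mxE.
  have [->|_] := eqVneq; last exact: homog_of_deg0.
  by rewrite subrr; apply: homog_of_deg1.
case: (split_ordP i) => i' ->; last by rewrite col_mxEd mxE; apply: homog_of_deg0.
rewrite col_mxEu mxE !ord1.
by rewrite (_ : _ - _ - _ = e (lshift p i') - d) //; ring.
Qed.
End KoszulDegrees.

(** * Graded resolutions of length three *)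

Section LengthThree.
Variables (k : fieldType) (r : nat).
Local Notation R := {mpoly k[r]}.
Variables (I : R -> Prop) (a b : nat).
Variables (M : 'rV[R]_a) (A : 'M[R]_(a, b)) (rho : 'cV[R]_b).

Lemma graded_res3 (d1 : 'I_a -> int) (d2 : 'I_b -> int) (d3 : int) :
  (forall p, I p <-> exists w : 'cV_a, p%:M = M *m w) ->
  exact_mx M A -> exact_mx A rho ->
  (forall v : 'cV[R]_1, rho *m v = 0 -> v = 0) ->
  (forall i j, homog_of_deg (d1 j) (M i j)) ->
  (forall i j, homog_of_deg (d2 j - d1 i) (A i j)) ->
  (forall i j, homog_of_deg (d3 - d2 i) (rho i j)) ->
  exists F : graded_res I [:: a; b; 1%N],
    [/\ res_diff F 0 = M, res_diff F 1 = A & res_diff F 2 = rho].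
Proof.
move=> imM exMA exAr injr homM homA homr; pose t := [:: a; b; 1%N].
pose diff i : 'M[R]_(rk t i, rk t i.+1) :=
  match i with 0%N => M | 1%N => A | 2%N => rho | _ => 0 end.
pose deg i : 'I_(rk t i) -> int :=
  match i with 1%N => d1 | 2%N => d2 | 3%N => fun=> d3 | _ => fun=> 0 end.
have rk0 i : rk t i.+4 = 0%N by rewrite /rk nth_default.
have deg0 j : deg 0%N j = 0 by [].
have homogd i x y : homog_of_deg (deg i.+1 y - deg i x) (diff i x y).
  move: i x y => [|[|[|i]]] x y //=; first by rewrite subr0.
  by rewrite mxE; apply: homog_of_deg0.
have exactd i : exact_mx (diff i) (diff i.+1).
  move: i => [|[|[|i]]] // v; split.
  - by move=> /injr ->; exists 0; rewrite mul0mx.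
  - by case=> w ->; rewrite mul0mx mulmx0.
  - move=> _; exists 0; rewrite mul0mx; apply/matrixP=> x y.
    by have := ltn_ord x; rewrite [X in (_ < X)%N]rk0.
  - by rewrite mul0mx.
by exists (@GradedRes _ _ I t diff deg deg0 homogd imM exactd).
Qed.

Lemma minimal_res3 (F : graded_res I [:: a; b; 1%N]) :
  (forall i j, (res_diff F 0 i j)@_0%MM = 0) ->
  (forall i j, (res_diff F 1 i j)@_0%MM = 0) ->
  (forall i j, (res_diff F 2 i j)@_0%MM = 0) ->
  minimal_res F.
Proof.
move=> F0 F1 F2 [|[|[|i]]] // x y.
by have := ltn_ord y; rewrite [X in (_ < X)%N]/rk nth_default.
Qed.
End LengthThree.

(** * Minimality, and the resolution of the truncated minors *)

Section Main.
Variables (k : fieldType) (r : nat).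
Local Notation R := {mpoly k[r]}.

Lemma const_mulmx m p q (A : 'M[R]_(m, p)) (C : 'M[R]_(p, q)) :
  (forall i j, (A i j)@_0%MM = 0) -> forall i j, ((A *m C) i j)@_0%MM = 0.
Proof.
move=> A0 i j; rewrite mxE raddf_sum big1 // => l _.
by rewrite -[LHS]/(mcoeff 0%MM _) rmorphM /= A0 mul0r.
Qed.

Lemma const_signed_minor n (B : 'M[R]_(n.+2, n.+1)) i :
  (forall i j, (B i j)@_0%MM = 0) -> (signed_minor B i)@_0%MM = 0.
Proof.
move=> B0; rewrite -[LHS]/(mcoeff 0%MM _) rmorphM /= -det_map_mx.
rewrite (_ : map_mx _ _ = 0) ?det0 ?mulr0 //.
by apply/matrixP=> a b; rewrite !mxE; exact: B0.
Qed.

Lemma min_num_gens_same (I J : R -> Prop) m :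
  same_ideal I J -> min_num_gens I m -> min_num_gens J m.
Proof.
move=> IJ [[s [Is sm]] mI]; split.
  by exists s; split=> // p; rewrite -IJ.
by move=> s' Js'; apply: mI => p; rewrite IJ.
Qed.

Lemma min_num_gens_regular3 p (h : 'rV[R]_3) :
  regular_seq [:: h 0 0; h 0 1; h 0 2] -> (forall i, (h 0 i)@_0%MM = 0) ->
  min_num_gens
    (ideal_gen [seq (col_mx h^T 0 : 'cV_(3 + p)) i ord0 | i <- enum 'I_(3 + p)]) 3.
Proof.
move=> hreg h0.
apply: (min_num_gens_same _ (@min_num_gens_row _ _ _ h _)); last first.
  move=> v /(koszul_exact1 hreg)[u ->] i; apply: const_mulmx => x y.
  by rewrite mxE mcoeffB !mcoeffMn !h0 !mul0rn subrr.
move=> x; rewrite (_ : [seq _ | i <- enum 'I_(3 + p)] =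
    [seq (row_mx h 0 : 'rV_(3 + p)) 0 i | i <- enum 'I_(3 + p)]); last first.
  apply: eq_map => i; case: (split_ordP i) => j ->.
    by rewrite col_mxEu row_mxEl mxE.
  by rewrite col_mxEd row_mxEr !mxE.
rewrite !ideal_gen_rowP; split=> -[w ->].
  by exists (col_mx w 0); rewrite mul_row_col mul0mx addr0.
by exists (usubmx w); rewrite -[w in LHS]vsubmxK mul_row_col mul0mx addr0.
Qed.
End Main.

Theorem proposition2p15 (k : fieldType) (r n : nat)
    (hr : (3 <= r)%N) (hn : (3 <= n)%N)
    (B : 'M[{mpoly k[r]}]_(n.+1, n)) (h1 h2 h3 : {mpoly k[r]})
    (hB : min_hilbert_burch B)
    (hlast : forall j : 'I_n, B ord_max j = [:: h1; h2; h3]`_j)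
    (hreg : regular_seq [:: h1; h2; h3]) :
  let I := ideal_gen
    [seq signed_minor B (widen_ord (leqnSn n) i) | i <- enum 'I_n] in
  gen_gorenstein3 I /\
  exists nuI z : nat, [/\ min_num_gens I nuI, has_zeta I z & nuI = (z + 3)%N].
Proof.
move=> I.
case: n hn B hB hlast @I => [|[|[|p]]] // _ B [J [F [_ _ minF FB]]] hlast I.
pose n := p.+3; pose d : 'I_n.+1 -> int := res_deg F (i := 1).
pose e : 'I_n -> int := res_deg F (i := 2).
have homB i j : homog_of_deg (e j - d i) (B i j).
  by rewrite -FB; apply: (@res_homog _ _ _ _ F 1).
have B0 i j : (B i j)@_0%MM = 0 by rewrite -FB; apply: minF.
have exFB : exact_mx (res_diff F 0 : 'rV_n.+1) B.
  by rewrite -FB; apply: (@res_exact _ _ _ _ F 0).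
have injB (w : 'cV_n) : B *m w = 0 -> w = 0.
  rewrite -FB => /(@res_exact _ _ _ _ F 1 w).1[v ->].
  by apply/matrixP=> i j; rewrite !mxE big1 // => -[].
pose h : 'rV[{mpoly k[r]}]_3 := \row_i [:: h1; h2; h3]`_i.
have hregh : regular_seq [:: h 0 0; h 0 1; h 0 2] by rewrite !mxE.
have lastE : row ord_max B = row_mx h 0 :> 'rV_(3 + p).
  apply/rowP=> j; rewrite mxE hlast; case: (split_ordP j) => i ->.
    by rewrite row_mxEl mxE.
  by rewrite row_mxEr mxE nth_default.
have hE i : h 0 i = B ord_max (lshift p i).
  by have /rowP/(_ (lshift p i)) := lastE; rewrite row_mxEl mxE.
have h0 i : (h 0 i)@_0%MM = 0 by rewrite hE B0.
pose K : 'M[{mpoly k[r]}]_(3 + p) := block_mx (koszul h) 0 0 1%:M.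
pose rho : 'cV[{mpoly k[r]}]_(3 + p) := col_mx h^T 0.
pose A : 'M_n := rowsub (widen_ord (leqnSn n)) B *m K.
pose M : 'rV_n := \row_i signed_minor B (widen_ord (leqnSn n) i).
have exHK : exact_mx (row ord_max B) K.
  by rewrite lastE; exact: exact_pad (koszul_exact1 hregh).
have exKrho : exact_mx K rho by exact: exact_pad_last (koszul_exact2 hregh).
have exMA : exact_mx M A.
  have := exact_upper (signed_minors_exact exFB injB) exHK.
  by congr (exact_mx _ _); apply/rowP=> i; rewrite !mxE.
have exArho : exact_mx A rho := exact_upper_mul injB exHK exKrho.
have injrho (v : 'cV_1) : rho *m v = 0 -> v = 0.
  rewrite mul_col_mx mul0mx => /eqP; rewrite col_mx_eq0 eqxx andbT => /eqP.
  exact: regular_row_inj.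
have A0 i j : (A i j)@_0%MM = 0 by apply: const_mulmx => x y; rewrite mxE.
have IE : I = ideal_gen [seq M 0 i | i <- enum 'I_n].
  by congr ideal_gen; apply: eq_map => i; rewrite mxE.
have imM q : I q <-> exists w : 'cV_n, q%:M = M *m w by rewrite IE ideal_gen_rowP.
have rho0 i j : (rho i j)@_0%MM = 0.
  case: (split_ordP i) => l ->; first by rewrite col_mxEu mxE ord1 h0.
  by rewrite col_mxEd mxE mcoeff0.
have [G minG rhoG] : exists2 G : graded_res I [:: n; n; 1%N],
    minimal_res G & res_diff G 2 = rho.
  have [i|f [f' [homK homrho]]] := @koszul_pad_homog _ _ p h e (d ord_max).
    by rewrite hE; apply: homB.
  pose s := \sum_j e j - \sum_l d l.
  (* B_i has degree s + deg (i-th row), so all degrees are shifted by s. *)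
  have [|||G [G0 G1 G2]] := @graded_res3 _ _ I _ _ M A rho
    (fun i => s + d (widen_ord (leqnSn n) i)) (fun j => s + f j) (s + f')
    imM exMA exArho injrho.
  - by move=> i j; rewrite mxE; apply: homog_signed_minor.
  - move=> i j; rewrite [s + _]addrC addrKA; 
    apply: (homog_of_deg_mulmx (d := fun i => d (widen_ord _ i)) (e := e)) => //.
    by move=> x y; rewrite mxE; apply: homB.
  - by move=> i j; rewrite [s + _]addrC addrKA; apply: homrho.
  exists G => //; apply: minimal_res3 => i j; rewrite ?G0 ?G1 ?G2 //.
  by rewrite mxE; apply: const_signed_minor.
have nuI : min_num_gens I n.
  rewrite IE; apply: min_num_gens_row => v /exMA[w ->] i.
  exact: const_mulmx.
split; first split.
- split; first by exists [:: n; n; 1%N].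
  by move=> t; apply: (res_length_ge3 imM exMA exArho injrho).
- by exists n, n, G.
exists n, p; split=> //; last by rewrite addn3.
exists n, G, n, 3; split=> //; last by rewrite addn3.
by rewrite /rho_ideal rhoG; apply: min_num_gens_regular3.
Qed.
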